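(* Suppose that $\chi\le\theta\le\kappa$ are infinite regular cardinals such that $\max\{\chi,\aleph_1\}<\kappa$. If $\square(\kappa)$ holds, then so does $\mathrm{U}_1(\kappa,2,\theta,\chi)$.
   Context: Work in ZFC. For sets of ordinals $a,b$, write $a<b$ iff $\alpha<\beta$ for all $\alpha\in a$ and $\beta\in b$. For an ordinal $\sigma$, $[\kappa]^\sigma$ is the collection of all subsets of $\kappa$ of order type $\sigma$. As an exception, $[\kappa]^2:=\{(\alpha,\beta)\mid \alpha<\beta<\kappa\}$, and for a collection $\mathcal A$ of sets of ordinals, $[\mathcal A]^2:=\{(a,b)\in\mathcal A\times\mathcal A\mid a<b\}$. $\mathrm{U}_1(\kappa,2,\theta,\chi)$ asserts the existence of a coloring $c:[\kappa]^2\rightarrow\theta$ such that for every $\sigma<\chi$, every pairwise disjoint subfamily $\mathcal A\subseteq[\kappa]^\sigma$ of size $\kappa$, and every $\epsilon<\theta$, there exist $(a,b)\in[\mathcal A]^2$ and $\tau<\theta$ with $\tau>\epsilon$ such that $c[a\times b]=\{\tau\}$. For a set of ordinals $C$, $\mathrm{acc}(C):=\{\alpha\in C\mid \sup(C\cap\alpha)=\alpha>0\}$. For a regular uncountable cardinal $\kappa$, $\square(\kappa)$ asserts the existence of a sequence $\langle C_\alpha\mid\alpha<\kappa\rangle$ such that: (1) for every $\alpha<\kappa$, $C_\alpha$ is a closed subset of $\alpha$ with $\sup(C_\alpha)=\sup(\alpha)$; (2) for all $\alpha<\kappa$ and $\delta\in\mathrm{acc}(C_\alpha)$, $C_\alpha\cap\delta=C_\delta$;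 (3) there is no club $C$ in $\kappa$ such that $C\cap\alpha=C_\alpha$ for all $\alpha\in\mathrm{acc}(C)$. *)

(* Defs.v *)
From mathcomp Require Import all_boot all_order.
From mathcomp Require Import boolp classical_sets functions cardinality.
From mathcomp Require Export wochoice.

Set Implicit Arguments.
Unset Strict Implicit.
Unset Printing Implicit Defensive.

Import Order.TTheory.

Local Open Scope classical_set_scope.
Local Open Scope card_scope.
Local Open Scope order_scope.

(* The ordinals are the points of a totally ordered type [O], which the theorem
   assumes to be well-ordered, with no bound on its length: every ordinal occurs
   as a point of such an [O].  In the von Neumann reading, an ordinal [a] is
   its set of predecessors [seg a]. *)

Section Ordinals.
Context {d : Order.disp_t} {O : orderType d}.
Implicit Types (a b C D : set O) (alpha beta delta sigma kappa theta chi : O).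

Definition seg alpha : set O := [set x | x < alpha].

Definition has_otype a sigma : Prop :=
  exists f : O -> O,
    (forall x y, x < sigma -> y < sigma -> x < y -> f x < f y) /\
    f @` seg sigma = a.

Definition is_cardinal kappa : Prop :=
  forall alpha, alpha < kappa -> ~ (seg alpha #= seg kappa).

Definition cofinal_in kappa C : Prop :=
  C `<=` seg kappa /\
  forall alpha, alpha < kappa -> exists2 beta, C beta & alpha <= beta.

Definition is_cof kappa sigma : Prop :=
  (exists2 C, cofinal_in kappa C & has_otype C sigma) /\
  forall beta, (exists2 C, cofinal_in kappa C & has_otype C beta) ->
    sigma <= beta.

Definition infinite_regular_cardinal kappa : Prop :=
  [/\ infinite_set (seg kappa), is_cardinal kappa & is_cof kappa kappa].

Definition is_aleph1 alpha : Prop :=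
  ~ countable (seg alpha) /\ forall beta, beta < alpha -> countable (seg beta).

(* sup (C `&` delta) = delta > 0; for ordinals, delta > 0 says that delta has a
   predecessor. *)
Definition is_acc_point C delta : Prop :=
  supremums (C `&` seg delta) delta /\ seg delta !=set0.

Definition acc C : set O := [set delta | C delta /\ is_acc_point C delta].

Definition closed_subset_of alpha C : Prop :=
  C `<=` seg alpha /\
  forall delta, delta < alpha -> is_acc_point C delta -> C delta.

Definition club_in kappa C : Prop :=
  closed_subset_of kappa C /\ cofinal_in kappa C.

(* [supremums] is the set of least upper bounds: the equation between the two
   sets of suprema in [square] is sup (C alpha) = sup alpha.  It also covers
   sup of the empty set, namely the least ordinal, and sup (beta + 1) = beta.
   Only the values [C alpha] with [alpha < kappa] matter. *)
Definition square kappa : Prop :=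
  exists C : O -> set O,
    [/\ (forall alpha, alpha < kappa ->
           closed_subset_of alpha (C alpha) /\
           supremums (C alpha) = supremums (seg alpha)),
        (forall alpha delta, alpha < kappa -> acc (C alpha) delta ->
           C alpha `&` seg delta = C delta)
      & ~ (exists D, club_in kappa D /\
             forall alpha, acc D alpha -> D `&` seg alpha = C alpha)].

Definition set_lt a b : Prop :=
  forall alpha beta, a alpha -> b beta -> alpha < beta.

Definition subsets_of_otype kappa sigma : set (set O) :=
  [set a | a `<=` seg kappa /\ has_otype a sigma].

Definition ordinal_pairs kappa : set (O * O) :=
  [set p | p.1 < p.2 /\ p.2 < kappa].

Definition family_pairs (A : set (set O)) : set (set O * set O) :=
  [set p | [/\ A p.1, A p.2 & set_lt p.1 p.2]].

(* U_1(kappa, 2, theta, chi).  A coloring is a total function of which only the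
   values on [ordinal_pairs kappa] matter. *)
Definition U1_2 kappa theta chi : Prop :=
  exists c : O * O -> O,
    set_fun (ordinal_pairs kappa) (seg theta) c /\
    forall sigma, sigma < chi ->
    forall A : set (set O), A `<=` subsets_of_otype kappa sigma ->
      trivIset A id -> A #= seg kappa ->
    forall epsilon, epsilon < theta ->
      exists a b tau,
        [/\ family_pairs A (a, b), tau < theta, epsilon < tau
          & c @` (a `*` b) = [set tau]].

End Ordinals.

(* Main.v *)
(* Walk from beta down to alpha along a square(kappa)-sequence C, stepping from b
   to min (C b \ alpha).  Non-threadability gives an eta such that
   min (C b \ eta) takes kappa many values on stationary sets; reducing this value
   to a regular mu < kappa with chi <= mu yields a level h : kappa -> mu that is
   constant along coherence (h c = h b for c in acc (C b)) and has all fibres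
   stationary.  The colour of (alpha, beta) is read off the point of the walk at
   which h is maximal: its level if theta < kappa (with mu = theta), the point
   itself if theta = kappa (with mu = chi).
   To make the colour constant on a `*` b, choose points a < c < xi < delta < b
   such that all walks from b to a follow the walk from delta to c in between:
   delta of cofinality chi handles all of b at once, c is a limit of members of A
   whose walks from c have h bounded by one i < mu (this needs cf c <> mu, which
   is where aleph1 < kappa enters), and xi in (c, delta) has a level h xi above
   everything seen on the walks from b to delta and from c to a. *)
Require Import Defs.
From mathcomp Require Import all_boot all_order.
From mathcomp Require Import boolp classical_sets functions cardinality.

Set Implicit Arguments.
Unset Strict Implicit.
Unset Printing Implicit Defensive.

Import Order.TTheory.

Local Open Scope order_scope.
Local Open Scope card_scope.
Local Open Scope classical_set_scope.

(** * Least elements, recursion and cofinality in a well-order *)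

Section WellOrdered.
Context {d : Order.disp_t} {O : orderType d}.
(* [o] is only the junk value of [least] on the empty set. *)
Context (wo : well_order (<=%O : rel O)) (o : O).
Implicit Types (P B : set O) (x y i j k l : O) (F G f : O -> O).

Definition least P := xget o [set x | P x /\ forall y, P y -> x <= y].

Lemma leastP P : P !=set0 -> P (least P) /\ forall y, P y -> least P <= y.
Proof.
move=> [x Px]; rewrite /least; case: xgetP => [z _ //|nP].
have [|z [[Pz zmin] _]] := wo (A := [pred x | `[< P x >]]).
  by exists x; apply/asboolP.
case: (nP z); split; first exact/asboolP.
by move=> y Py; apply: zmin; apply/asboolP.
Qed.

Lemma least_in P x : P x -> P (least P).
Proof. by move=> Px; case: (leastP (ex_intro _ x Px)). Qed.

Lemma least_le P x : P x -> least P <= x.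
Proof. by move=> Px; case: (leastP (ex_intro _ x Px)) => _ /(_ _ Px). Qed.

Lemma wo_ind (P : O -> Prop) :
  (forall x, (forall y, y < x -> P y) -> P x) -> forall x, P x.
Proof.
move=> step x; apply: contrapT => nPx.
apply: (least_in (P := [set y | ~ P y]) nPx); apply: step => y ylt.
apply: contrapT => nPy.
by move: (least_le (P := [set y | ~ P y]) nPy); rewrite leNgt ylt.
Qed.

Lemma lt_wf : well_founded (fun x y : O => x < y).
Proof. by apply: wo_ind => x IH; constructor. Qed.

(** Greedy recursion. A value is meaningful only once admissible points are shown to exist. *)
Lemma wo_rec B (Q : O -> O -> Prop) : exists F, forall i,
  F i = least [set x | B x /\ forall j, j < i -> Q (F j) x].
Proof.
pose step i (F : forall j, j < i -> O) : O :=
  least [set x | B x /\ forall j (ji : j < i), Q (F j ji) x].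
exists (Fix lt_wf (fun=> O) step) => i; rewrite Fix_eq //.
move=> x f g fg; congr (least _); apply/seteqP.
by split=> y [By fy]; split=> // j jx; [rewrite -fg|rewrite fg].
Qed.

(** Enumerate [B] greedily in increasing order. If this never stalls below [k], it injects [seg k]
    into [B]; if it first stalls at [m], it has exhausted [B], which would then have type
    [m < k]. *)
Lemma cofinal_card k B : is_cof k k -> cofinal_in k B -> seg k #<= B.
Proof.
move=> [_ kmin] Bk; have [F FE] := wo_rec B (fun y x => y < x).
pose S i := [set x | B x /\ forall j, j < i -> F j < x].
have Fmono i j : j < i -> S i !=set0 -> F j < F i.
  by move=> ji /leastP; rewrite [F i]FE => -[[_ +] _]; exact.
have FB i : S i !=set0 -> B (F i).
  by move=> /leastP; rewrite [F i]FE => -[[+ _] _].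
have [Sne|/existsNP[i /not_implyP[ik Si]]] :=
    pselect (forall i, i < k -> S i !=set0).
  have Finj : {in seg k &, injective F}.
    move=> i j; rewrite !inE => ik jk Fij.
    by case: (ltgtP i j) => // ij; have := Fmono _ _ ij; rewrite Fij ltxx => abs;
      suff: false by []; apply: abs; apply: Sne.
  rewrite -(card_le_eql (inj_card_eq Finj)); apply: subset_card_le.
  by move=> _ [i ik <-]; apply: FB; apply: Sne.
pose m := least [set i | i < k /\ ~ (S i !=set0)].
have [mk Sm] : m < k /\ ~ (S m !=set0).
  exact: (@least_in [set i | i < k /\ ~ (S i !=set0)] i).
have mmin j : j < m -> S j !=set0.
  move=> jm; apply: contrapT => Sj.
  have : m <= j.
    by apply: (@least_le [set i | i < k /\ ~ (S i !=set0)]); split=> //; apply: lt_trans mk.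
  by rewrite leNgt jm.
suff : has_otype B m.
  move=> Bm; have : k <= m by apply: kmin; exists B.
  by rewrite leNgt mk.
exists F; split=> [x y xm ym xy|]; first by apply: Fmono => //; apply: mmin.
apply/seteqP; split=> [_ [j jm <-]|b Bb]; first by apply/FB/mmin.
have [j [jm bFj]] : exists j, j < m /\ b <= F j.
  apply: contrapT => nj; apply: Sm; exists b; split=> // j jm.
  by rewrite ltNge; apply/negP => bF; apply: nj; exists j.
pose P := [set j | j < m /\ b <= F j]; pose j0 := least P.
have [j0m bFj0] : P j0 by apply: (@least_in _ j).
exists j0 => //; apply/eqP; rewrite eq_le bFj0 andbT [F j0]FE; apply: least_le.
split=> // p pj0; rewrite ltNge; apply/negP => bFp.
have : j0 <= p by apply: least_le; split=> //; apply: lt_trans j0m.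
by rewrite leNgt pj0.
Qed.

Lemma cof_bounded k B : is_cof k k -> B `<=` seg k -> ~ (seg k #<= B) ->
  exists2 m, m < k & forall b, B b -> b < m.
Proof.
move=> kk Bk nB; apply: contrapT => nm; apply: nB; apply: cofinal_card => //.
split=> // a ak; apply: contrapT => nb; apply: nm; exists a => // b Bb.
by rewrite ltNge; apply/negP => ab; apply: nb; exists b.
Qed.

Lemma seg_sub x y : x <= y -> seg x `<=` seg y.
Proof. by move=> xy z /= zx; apply: lt_le_trans xy. Qed.

Lemma small_card T (D : set T) k l : is_cardinal k -> l < k -> D #<= seg l -> ~ (seg k #<= D).
Proof.
move=> kcard lk Dl kD; apply: (kcard l lk); rewrite card_eq_le.
by rewrite (subset_card_le (seg_sub (ltW lk))) (card_le_trans kD Dl).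
Qed.

(** * Regular cardinals: uniform bounds, closure points, stationary sets *)

Section Regular.
Context (k : O) (kreg : infinite_regular_cardinal k).

Lemma reg_bounded l f : l < k -> (forall x, x < l -> f x < k) ->
  exists2 m, m < k & forall x, x < l -> f x < m.
Proof.
have [_ kcard kcof] := kreg; move=> lk fk.
have [|| m mk fm] := @cof_bounded k (f @` seg l) kcof.
- by move=> _ [x xl <-]; apply: fk.
- exact: (small_card kcard lk (card_image_le _ _)).
by exists m => // x xl; apply: fm; exists x.
Qed.

Lemma reg_succ x : x < k -> exists2 y, y < k & x < y.
Proof.
have [kinf _ kcof] := kreg; move=> xk.
have [|| m mk xm] := @cof_bounded k [set x] kcof; last by exists m => //; apply: xm.
- by move=> _ ->.
- by move=> /card_le_finite/(_ (finite_set1 _)).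
Qed.

Lemma reg_pos : exists z, z < k.
Proof. by have [/infinite_setN0[z zk] _ _] := kreg; exists z. Qed.

Lemma reg_countable B : ~ countable (seg k) -> B `<=` seg k -> countable B ->
  exists2 m, m < k & forall b, B b -> b < m.
Proof.
have [_ _ kcof] := kreg; move=> kunc Bk Bc; apply: cof_bounded => // kB.
by apply: kunc; apply: sub_countable Bc.
Qed.

Lemma otype_bounded s a f : s < k -> has_otype a s ->
  (forall x, a x -> f x < k) -> exists2 m, m < k & forall x, a x -> f x < m.
Proof.
move=> sk [e [_ <-]] fk.
have [|m mk fm] := @reg_bounded s (f \o e) sk.
  by move=> x xs; apply: fk; exists x.
by exists m => // _ [x xs <-]; apply: fm.
Qed.

Lemma reg_max x y : x < k -> y < k -> exists2 z, z < k & x < z /\ y < z.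
Proof.
move=> xk yk; have [|z zk mz] := @reg_succ (Order.max x y); first by rewrite gt_max xk.
by exists z => //; move: mz; rewrite gt_max => /andP[].
Qed.

(** Fewer than [k] least witnesses have a common bound below [k], and [R] passes up to it. *)
Lemma reg_collect s a (R : O -> O -> Prop) : s < k -> has_otype a s ->
  (forall x m m', R x m -> m <= m' -> m' < k -> R x m') ->
  (forall x, a x -> exists2 m, m < k & R x m) ->
  exists2 m, m < k & forall x, a x -> R x m.
Proof.
move=> sk sa Rup ex; pose M x := [set m | m < k /\ R x m].
have MP x : a x -> M x (least (M x)) by move=> /ex[m mk Rm]; apply: (@least_in _ m).
have [|m mk Mm] := otype_bounded sk sa (f := fun x => least (M x)).
  by move=> x /MP[].
by exists m => // x ax; have [_ RM] := MP x ax; apply: Rup RM (ltW (Mm x ax)) mk.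
Qed.

Lemma seg_otype l : has_otype (seg l) l.
Proof. by exists id; split=> //; rewrite image_id. Qed.

Lemma reg_collect_le l (R : O -> O -> Prop) : l < k ->
  (forall x m m', R x m -> m <= m' -> m' < k -> R x m') ->
  (forall x, x <= l -> exists2 m, m < k & R x m) ->
  exists2 m, m < k & forall x, x <= l -> R x m.
Proof.
move=> lk Rup ex; have [l' l'k ll'] := reg_succ lk.
have [||m mk Rm] := @reg_collect l' (seg l') (fun x m => x <= l -> R x m) l'k (seg_otype l').
- by move=> x m m' Rm mm' m'k /Rm xm; apply: Rup mm' m'k.
- move=> x _; have [/ex[m mk Rm]|lx] := leP x l; first by exists m.
  by exists l.
by exists m => // x xl; apply: Rm => //; apply: le_lt_trans ll'.
Qed.

Definition maps_seg G := forall x, x < k -> G x < k.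

Definition closed_under G delta := forall x, x < delta -> G x < delta.

Definition limit_length nu :=
  (exists j, j < nu) /\ forall j, j < nu -> exists2 j', j' < nu & j < j'.

(** Each [e j] exceeds [a], the earlier terms and all values of [G] up to them, so the limit [delta]
    is closed under [G]; it inherits the cofinality of [nu]. *)
Lemma closed_seq nu G a : nu < k -> limit_length nu -> maps_seg G -> a < k ->
  exists e delta,
    [/\ forall i j, i < j -> j < nu -> e i < e j,
        forall j, j < nu -> e j < delta
      & forall x, x < delta -> exists2 j, j < nu & x <= e j]
    /\ [/\ a < delta, delta < k & closed_under G delta].
Proof.
move=> nuk [[j0 j0nu] nulim] Gk ak.
pose B := [set x | a < x /\ x < k].
pose Q y x := y < x /\ forall z, z <= y -> G z < x.
have [F FE] := wo_rec B Q.
pose S j := [set x | B x /\ forall i, i < j -> Q (F i) x].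
have SF j : S j !=set0 -> S j (F j) by rewrite FE => /leastP[].
have Sne j : j < k -> S j !=set0.
  elim/wo_ind: j => j IH jk.
  have [||m mk mP] := @reg_collect j (seg j) (fun i m => Q (F i) m) jk (seg_otype j).
  - move=> x m m' [xm Gm] mm' _; split; first exact: lt_le_trans mm'.
    by move=> z /Gm zm; apply: lt_le_trans mm'.
  - move=> i ij; have ik := lt_trans ij jk.
    have [[_ Fk] _] := SF _ (IH _ ij ik).
    have [||m mk mP] := @reg_collect_le (F i) (fun z m => G z < m) Fk.
    + by move=> x m m' xm mm' _; apply: lt_le_trans mm'.
    + by move=> z zF; apply: reg_succ; apply: Gk; apply: le_lt_trans Fk.
    have [m' m'k [mm' Fm']] := reg_max mk Fk.
    by exists m' => //; split=> // z /mP zm; apply: lt_trans mm'.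
  have [m' m'k [mm' am']] := reg_max mk ak.
  exists m'; split=> // i /mP[Fm Gm]; split; first exact: lt_trans mm'.
  by move=> z /Gm zm; apply: lt_trans mm'.
have FQ i j : i < j -> j < nu -> Q (F i) (F j).
  by move=> ij jnu; have [_] := SF j (Sne _ (lt_trans jnu nuk)); apply.
have FB j : j < nu -> B (F j).
  by move=> jnu; have [] := SF j (Sne _ (lt_trans jnu nuk)).
have [|m mk Fm] := @reg_bounded nu F nuk; first by move=> x /FB[].
pose U := [set m | forall j, j < nu -> F j < m].
have UF : U (least U) by apply: (@least_in _ m).
exists F, (least U); split; split=> //.
- by move=> i j ij jnu; have [] := FQ i j ij jnu.
- move=> x xU; apply: contrapT => nx.
  have /least_le : U x.
    by move=> j jnu; rewrite ltNge; apply/negP => xF; apply: nx; exists j.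
  by rewrite leNgt xU.
- by apply: lt_trans (UF _ j0nu); have [] := FB _ j0nu.
- by apply: le_lt_trans mk; apply: least_le.
- move=> x xU; have [j jnu xF] : exists2 j, j < nu & x <= F j.
    apply: contrapT => nx.
    have /least_le : U x.
      by move=> j jnu; rewrite ltNge; apply/negP => xF; apply: nx; exists j.
    by rewrite leNgt xU.
  have [j' j'nu jj'] := nulim _ jnu.
  by have [_ /(_ _ xF)GF] := FQ _ _ jj' j'nu; apply: lt_trans (UF _ j'nu).
Qed.

(* The sets closed under some [G] generate the club filter on [k], so this is
   stationarity in the usual sense. *)
Definition stationary (S : set O) := forall G a, maps_seg G -> a < k ->
  exists delta, S delta /\ [/\ a < delta, delta < k & closed_under G delta].

(** A diagonal intersection of clubs: [G] at [z] dominates the witnesses for all [S x] with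
    [x <= z], so closure under [G] implies closure under the witness of every smaller [x]. *)
Lemma diag_nonstationary (S : O -> set O) :
  (forall x, x < k -> ~ stationary (S x)) ->
  exists2 G, maps_seg G &
    forall delta, delta < k -> closed_under G delta ->
      forall x, x < delta -> ~ S x delta.
Proof.
move=> nS.
have /choice[w wP] : forall x, exists Ga : (O -> O) * O, x < k ->
    [/\ maps_seg Ga.1, Ga.2 < k & forall delta, Ga.2 < delta -> delta < k ->
       closed_under Ga.1 delta -> ~ S x delta].
  move=> x; have [xk|] := boolP (x < k); last by exists (id, o).
  apply: contrapT => nw; apply: (nS _ xk) => G a Gk ak.
  apply: contrapT => nd; apply: nw; exists (G, a) => _; split=> // delta ad dk Gd Sd.
  by apply: nd; exists delta.
pose M z := [set m | m < k /\ forall x y, x <= z -> y <= z -> (w x).2 < m /\ (w x).1 y < m].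
have MP z : z < k -> M z (least (M z)).
  move=> zk.
  have [||m mk mP] := @reg_collect_le z
      (fun x m => (w x).2 < m /\ forall y, y <= z -> (w x).1 y < m) zk.
  - move=> x m m' [m1 m2] mm' _; split=> [|y /m2 m2y]; exact: lt_le_trans mm'.
  - move=> x xz; have [Gk ak _] := wP x (le_lt_trans xz zk).
    have [||m mk mP] := @reg_collect_le z (fun y m => (w x).1 y < m) zk.
    + by move=> y m m' xm mm' _; apply: lt_le_trans mm'.
    + by move=> y yz; apply: reg_succ; apply: Gk; apply: le_lt_trans zk.
    have [m' m'k [mm' Fm']] := reg_max mk ak.
    by exists m' => //; split=> // y /mP ym; apply: lt_trans mm'.
  by apply: (@least_in _ m); split=> // x y xz yz; have [? ] := mP x xz; split; auto.
exists (fun z => least (M z)) => [x /MP[]//|delta dk cl x xd].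
have xk := lt_trans xd dk; have [_ _] := wP x xk; apply=> //.
  by have [_ /(_ x x (lexx _) (lexx _))[+ _]] := MP x xk => /lt_trans; apply; apply: cl.
move=> y yd; set z := Order.max x y.
have zd : z < delta by rewrite gt_max xd.
have [_ /(_ x y)[]] := MP z (lt_trans zd dk); rewrite ?le_max ?lexx ?orbT // => _ wm.
by apply: lt_trans wm (cl _ zd).
Qed.

(** Were every fibre nonstationary, [S] would contain a [delta] closed under the diagonal [G]; but
    [delta] lies in the fibre of [f delta < delta], which [G] excludes. *)
Lemma fodor S f : stationary S -> (forall x, S x -> x < k -> f x < x) ->
  exists2 z, z < k & stationary [set x | S x /\ f x = z].
Proof.
move=> Sst fS; apply: contrapT => nz.
have [x xk|G Gk GP] := @diag_nonstationary (fun z => [set x | S x /\ f x = z]).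
  by move=> st; apply: nz; exists x.
have [a ak] := reg_pos; have [delta [Sd [_ dk cl]]] := Sst G a Gk ak.
by apply: (GP delta dk cl (f delta)); first exact: fS.
Qed.

End Regular.

Lemma is_acc_pointP B x : is_acc_point B x <->
  seg x !=set0 /\ forall y, y < x -> exists z, [/\ B z, y < z & z < x].
Proof.
split=> [[[xub xlub] x0]|[x0 Bx]]; split=> //.
  move=> y yx; apply: contrapT => nz.
  have : x <= y.
    apply: xlub => z [Bz zx]; rewrite leNgt; apply/negP => yz.
    by apply: nz; exists z.
  by rewrite leNgt yx.
split=> [z [_ /ltW]//|y yub]; rewrite leNgt; apply/negP => yx.
have [z [Bz yz zx]] := Bx y yx.
by have := yub z (conj Bz zx); rewrite leNgt yz.
Qed.

(** * Walks along a coherent sequence *)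

Section Walks.
Context (k : O) (kreg : infinite_regular_cardinal k) (C : O -> set O).
Context (Cclosed : forall x, x < k ->
  closed_subset_of x (C x) /\ supremums (C x) = supremums (seg x)).
Context (Ccoh : forall x y, x < k -> acc (C x) y -> C x `&` seg y = C y).

Definition positive x := exists z, z < x.

(** If [C b] lay below [a], its supremum, which is that of [seg b], would be [a]; as a positive
    limit of [C b] below [b] it would belong to [C b]. *)
Lemma C_above a b : positive a -> a < b -> b < k -> exists x, C b x /\ a <= x.
Proof.
move=> apos ab bk; have [[Cb Ccl] Csup] := Cclosed bk.
apply: contrapT => nx.
have Ca x : C b x -> x < a.
  by move=> Cx; rewrite ltNge; apply/negP => ax; apply: nx; exists x.
pose s := least (ubound (seg b)).
have ubs : ubound (seg b) s by apply: (@least_in _ b) => z /ltW.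
have sups : supremums (seg b) s by split=> // z; apply: least_le.
move: (sups); rewrite -Csup => -[_ slub].
have sa : s = a.
  apply/eqP; rewrite eq_le ubs // andbT.
  by apply: slub => z /Ca/ltW.
subst a; apply: nx; exists s; split=> //; apply: Ccl => //.
rewrite /is_acc_point; suff -> : C b `&` seg s = C b by rewrite Csup.
by apply/seteqP; split=> [z []//|z Cz]; split=> //; apply: Ca.
Qed.

(* [nxt] need not be meaningful for [a] the least ordinal: [C 1] may be empty. *)
Definition nxt a b := least [set x | C b x /\ a <= x].

Lemma nxt_eq a b x : C b x -> a <= x -> (forall y, C b y -> a <= y -> x <= y) ->
  nxt a b = x.
Proof.
move=> Cx ax xmin; apply/eqP; rewrite eq_le least_le //=.
by have [? ?] := @least_in [set x | C b x /\ a <= x] x (conj Cx ax); apply: xmin.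
Qed.

Lemma nxtP a b : positive a -> a < b -> b < k ->
  [/\ C b (nxt a b), a <= nxt a b, nxt a b < b
    & forall y, C b y -> a <= y -> nxt a b <= y].
Proof.
move=> apos ab bk; have [x Px] := C_above apos ab bk.
have [Cn an] := @least_in [set x | C b x /\ a <= x] x Px.
have [[Cb _] _] := Cclosed bk.
by split=> // [|y Cy ay]; [apply: Cb|apply: least_le].
Qed.

(** By coherence [C c] is an initial segment of [C b], and it already has points above [a]. *)
Lemma nxt_acc a b c : b < k -> acc (C b) c -> a < c -> nxt a c = nxt a b.
Proof.
move=> bk Cc ac; have coh := Ccoh bk Cc; case: Cc => [Cbc /is_acc_pointP[_ cacc]].
have [z [Cz az zc]] := cacc a ac.
pose P := [set x | C b x /\ a <= x].
have Pz : P z by split=> //; apply: ltW.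
have [Cn an] : P (nxt a b) by apply: (@least_in _ z).
have nz : nxt a b <= z by apply: (@least_le P).
apply: nxt_eq => //; first by rewrite -coh; split=> //; apply: le_lt_trans zc.
by move=> y; rewrite -coh => -[Cy _] ay; apply: least_le.
Qed.

(** The walk includes its start [b] but not its end [a], so [h a] cannot affect the maximum of
    [h]. *)
Inductive visited a : O -> O -> Prop :=
| visited_refl b : a < b -> visited a b b
| visited_step b x : a < b -> visited a (nxt a b) x -> visited a b x.

Lemma visitedE a b x : a < b -> visited a b x = (x = b \/ visited a (nxt a b) x).
Proof.
move=> ab; apply/propext; split=> [v|[->|v]]; last 2 first.
- exact: visited_refl.
- exact: visited_step.
by case: v => [c _|c y _ v]; [left|right].
Qed.

Lemma visited_gt a b x : visited a b x -> a < x.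
Proof. by elim. Qed.

Lemma visited_lt a b x : visited a b x -> a < b.
Proof. by case. Qed.

Lemma visited_le a b x : positive a -> b < k -> visited a b x -> x <= b.
Proof.
move=> apos bk v; elim: v bk => // {b x} b x ab _ IH bk.
have [_ _ nb _] := nxtP apos ab bk.
by apply: le_trans (IH (lt_trans nb bk)) (ltW nb).
Qed.

(** If [c] is not in [acc (C b)], then [C b] has no points strictly between some [l < c] and [c]. *)
Lemma nxt_const c b : positive c -> c < b -> b < k -> ~ acc (C b) c ->
  exists2 l, l < c & forall a, l < a -> a < c -> nxt a b = nxt c b.
Proof.
move=> cpos cb bk nacc; have [[_ Ccl] _] := Cclosed bk.
have [Cn cn nb nmin] := nxtP cpos cb bk.
have [l lc lP] : exists2 l, l < c & forall y, C b y -> y < c -> y <= l.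
  apply: contrapT => nl; apply: nacc.
  have ac : is_acc_point (C b) c.
    apply/is_acc_pointP; split=> // y yc; apply: contrapT => nz; apply: nl.
    exists y => // z Cz zc; rewrite leNgt; apply/negP => yz.
    by apply: nz; exists z.
  by split=> //; apply: Ccl.
exists l => // a la ac; apply: nxt_eq => //; first exact: le_trans (ltW ac) cn.
move=> y Cy ay; apply: nmin => //; rewrite leNgt; apply/negP => yc.
by have := lP y Cy yc; rewrite leNgt (lt_le_trans la ay).
Qed.

(* The exception in the third clause: if the walk from [b] meets [c] as an
   accumulation point of some [C y], then [y] stands in for [c] on the longer walk. *)
Lemma walk_split c b : positive c -> c < b -> b < k ->
  exists2 l, l < c & forall a, l < a -> a < c -> forall x,
    [/\ visited a b x -> visited c b x \/ visited a c x,
        visited c b x -> visited a b x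
      & visited a c x -> visited a b x \/
          x = c /\ exists2 y, visited c b y & acc (C y) c].
Proof.
move=> cpos; elim/wo_ind: b => b IH cb bk.
have [z zc] := cpos.
have [Cn cn nb nmin] := nxtP cpos cb bk.
(* If [c] is in [acc (C b)], the walk from [b] to [c] is a single step, while towards [a < c] the
   points [b] and [c] step to the same point: [b] replaces [c]. *)
have [cacc|nacc] := pselect (acc (C b) c).
  exists z => // a za ac; have ab := lt_trans ac cb.
  have nc : nxt c b = c by apply: nxt_eq => //; case: cacc.
  have nabc := nxt_acc bk cacc ac.
  have vc x : visited c b x = (x = b).
    rewrite visitedE // nc; apply/propext; split=> [[//|/visited_lt]|->]; last by left.
    by rewrite ltxx.
  move=> x; rewrite vc (visitedE x ab) (visitedE x ac) nabc; split=> [[]|->|[->|]]; auto.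
  by right; split=> //; exists b => //; rewrite vc.
(* Otherwise, for [a] close to [c], the first step towards [a] is the one towards [c]; induction
   applies unless it lands on [c]. *)
have [l0 l0c nconst] := nxt_const cpos cb bk nacc.
have [l1 l1c l1P] : exists2 l, l < c & forall a, l < a -> a < c -> forall x,
    [/\ visited a (nxt c b) x -> visited c (nxt c b) x \/ visited a c x,
        visited c (nxt c b) x -> visited a (nxt c b) x
      & visited a c x -> visited a (nxt c b) x \/
          x = c /\ exists2 y, visited c (nxt c b) y & acc (C y) c].
  move: cn; rewrite le_eqVlt => /orP[/eqP <-|cn]; last exact: IH (lt_trans nb bk).
  by exists l0 => // a _ _ x; split; [right|move=> /visited_lt; rewrite ltxx|left].
exists (Order.max l0 l1); first by rewrite gt_max l0c.
move=> a; rewrite gt_max => /andP[l0a l1a] ac; have ab := lt_trans ac cb.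
have nE := nconst a l0a ac; move=> x; have [h1 h2 h3] := l1P a l1a ac x.
rewrite (visitedE x cb) (visitedE x ab) nE; split.
- by move=> [|/h1[]]; auto.
- by move=> [|/h2]; auto.
- move=> /h3[|[-> [y vy yc]]]; auto.
  by right; split=> //; exists y => //; rewrite visitedE //; right.
Qed.

(** * Non-threadability and the level function *)

Lemma stationary_sub (S S' : set O) : S `<=` S' -> stationary k S -> stationary k S'.
Proof.
by move=> SS' st G a Gk ak; have [x [/SS' Sx xP]] := st G a Gk ak; exists x.
Qed.

Context (nu : O) (nuk : nu < k) (nulim : limit_length nu).
Context (Cthread : ~ exists D, club_in k D /\
  forall x, acc D x -> D `&` seg x = C x).

Lemma closed_above G a : maps_seg k G -> a < k ->
  exists delta, [/\ a < delta, delta < k & closed_under G delta].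
Proof.
by move=> Gk ak; have [_ [delta [_ ?]]] := closed_seq kreg nuk nulim Gk ak; exists delta.
Qed.

(** Otherwise each [nxt x] is bounded by some [e x] off a nonstationary set. Diagonalising gives
    closure points [x < y] with [C y] unbounded in [x], hence a thread. *)
Lemma nxt_unbounded : exists eta, [/\ positive eta, eta < k
  & forall z, z < k -> stationary k [set x | eta < x /\ z <= nxt eta x]].
Proof.
apply: contrapT => neta.
have /choice[e eP] : forall x, exists z, x < k -> z < k /\
    (positive x -> ~ stationary k [set y | x < y /\ z <= nxt x y]).
  move=> x; apply: contrapT => nz; apply: neta; exists x.
  have xk : x < k by apply: contrapT => xk; apply: nz; exists o => /xk.
  have xpos : positive x by apply: contrapT => xpos; apply: nz; exists x.
  split=> // z zk; apply: contrapT => st; apply: nz; exists z => _; split=> //.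
have [a0 a0k] := reg_pos kreg.
(* Positivity is built into the sets because [eP] gives nonstationarity only at positive points. *)
have [x xk|G Gk GP] := @diag_nonstationary _ kreg
    (fun x => [set y | positive x /\ (x < y /\ e x <= nxt x y)]).
  have [_ nst] := eP x xk; move=> st; have xpos : positive x.
    by have [|_ [[+ _] _]] := st id a0 _ a0k.
  by apply: nst => //; apply: stationary_sub st => y [].
pose succ x := least [set y | x < y /\ y < k].
have succP x : x < k -> x < succ x /\ succ x < k.
  by move=> /(reg_succ kreg)[y yk xy]; apply: (@least_in [set y | x < y /\ y < k] y).
pose G' x := Order.max (G x) (Order.max (e x) (succ x)).
have G'k : maps_seg k G'.
  by move=> x xk; rewrite !gt_max Gk // (eP x xk).1 (succP x xk).2.
(* Along [E] the sets [C x] cohere, and their union would be a thread. *)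
pose E := [set x | [/\ a0 < x, x < k & closed_under G' x]].
have clE x y : E x -> y < x -> [/\ G y < x, e y < x & succ y < x].
  by move=> [_ _ cl] /cl; rewrite !gt_max => /and3P.
have Eacc x y : E x -> E y -> x < y -> acc (C y) x.
  move=> Ex Ey xy; have [a0x xk _] := Ex; have [_ yk _] := Ey.
  have xacc : is_acc_point (C y) x.
    apply/is_acc_pointP; split; first by exists a0.
    move=> w wx; have [_ _ swx] := clE x w Ex wx.
    have [wsw swk] := succP w (lt_trans wx xk).
    have swpos : positive (succ w) by exists w.
    have swy := lt_trans swx xy.
    have [Cn sn _ _] := nxtP swpos swy yk.
    (* This point of [C y] lies above [w] and, by the choice of [G], below [e (succ w) < x]. *)
    exists (nxt (succ w) y); split=> //; first exact: lt_le_trans sn.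
    have clG : closed_under G y by move=> v /(clE y v Ey)[].
    have := GP y yk clG _ swy; have [_ esx _] := clE x _ Ex swx => nS.
    apply: lt_trans esx; rewrite ltNge; apply/negP => en; apply: nS.
    by split.
  by split=> //; have [[_ Ccl] _] := Cclosed yk; apply: Ccl.
pose D := [set x | exists2 y, E y & C y x].
have Eabove x : x < k -> exists2 y, E y & x < y.
  move=> xk; have [|y [xy yk cl]] := @closed_above G' (Order.max a0 x) G'k.
    by rewrite gt_max a0k.
  by move: xy; rewrite gt_max => /andP[? ?]; exists y.
have DE y : E y -> D `&` seg y = C y.
  move=> Ey; have [_ yk _] := Ey; have [[Cy _] _] := Cclosed yk.
  apply/seteqP; split=> [x [[z Ez Cz] xy]|x Cx]; last by split; [exists y|apply: Cy].
  have [_ zk _] := Ez.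
  case: (ltgtP y z) Cz => [yz Cz|zy Cz|->//].
    by rewrite -(Ccoh zk (Eacc y z Ey Ez yz)).
  by move: Cz; rewrite -(Ccoh yk (Eacc z y Ez Ey zy)) => -[].
have Dk : D `<=` seg k.
  by move=> x [y [_ yk _] Cx]; have [[/(_ _ Cx)xy _] _] := Cclosed yk; apply: lt_trans yk.
have accD x y : E y -> x < y -> is_acc_point D x -> is_acc_point (C y) x.
  move=> Ey xy /is_acc_pointP[x0 xacc]; apply/is_acc_pointP; split=> // w /xacc[z [Dz wz zx]].
  by exists z; split=> //; rewrite -DE //; split=> //; apply: lt_trans xy.
apply: Cthread; exists D; split; first split.
- split=> // x /[dup] xk /Eabove[y Ey xy] /(accD x y Ey xy) xacc.
  by exists y => //; have [_ yk _] := Ey; have [[_ Ccl] _] := Cclosed yk; apply: Ccl.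
- split=> // x /Eabove[y Ey xy]; have [_ yk _] := Ey; have [z Ez yz] := Eabove y yk.
  by exists y; [exists z => //; have [] := Eacc y z Ey Ez yz|apply: ltW].
- move=> x [[y Ey Cx] xacc]; have [_ yk _] := Ey; have [[Cy _] _] := Cclosed yk.
  have xy : x < y by apply: Cy.
  rewrite -(Ccoh yk (conj Cx (accD x y Ey xy xacc))) -(DE y Ey).
  by apply/seteqP; split=> z /=; [move=> [? ?]; do 2?split=> //; apply: lt_trans xy|move=> [[]]].
Qed.

Lemma increasing_in (B : set O) mu : mu < k ->
  (forall x, x < k -> exists y, [/\ B y, x < y & y < k]) ->
  exists F, forall i, i < mu -> B (F i) /\ forall j, j < i -> F j < F i.
Proof.
move=> muk Bk; have [F FE] := wo_rec [set y | B y /\ y < k] (fun y x => y < x).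
pose S i := [set x | (B x /\ x < k) /\ forall j, j < i -> F j < x].
have SF i : i < k -> S i (F i).
  elim/wo_ind: i => i IH ik; rewrite FE.
  have [|m mk Fm] := @reg_bounded _ kreg i F ik.
    by move=> j ji; have [[]] := IH j ji (lt_trans ji ik).
  have [y [By my yk]] := Bk m mk.
  by apply: (@least_in (S i) y); split=> // j /Fm Fj; apply: lt_trans my.
by exists F => i imu; have [[? ?] ?] := SF i (lt_trans imu muk).
Qed.

(** The map [nxt eta] is regressive, so by [fodor] unboundedly many of its fibres are stationary;
    [h] indexes [mu] of them, and [nxt_acc] makes it coherent. *)
Lemma coherent_colouring mu : infinite_regular_cardinal mu -> mu < k ->
  exists h eta, [/\ eta < k, forall x, h x < mu,
    forall x y, x < k -> acc (C x) y -> eta < y -> h y = h x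
    & forall i, i < mu -> stationary k [set x | h x = i]].
Proof.
move=> mureg muk; have [eta [etapos etak etast]] := nxt_unbounded.
pose Z := [set z | stationary k [set x | eta < x /\ nxt eta x = z]].
have Zub x : x < k -> exists y, [/\ Z y, x < y & y < k].
  move=> /(reg_succ kreg)[x' x'k xx'].
  have [|y yk st] := fodor kreg (f := nxt eta) (etast x' x'k).
    by move=> z [ez _] zk; have [] := nxtP etapos ez zk.
  exists y; split=> //; first by apply: stationary_sub st => z /= [[]].
  have [a ak] := reg_pos kreg.
  have [//|z [[[_ xz] zy] _]] := st id a _ ak.
  by rewrite -zy; apply: lt_le_trans xz.
have [F FP] := increasing_in muk Zub.
have [m0 m0mu] := reg_pos mureg.
(* Inverse of [F], with default [m0] off the range. *)
pose psi z := xget m0 [set i | i < mu /\ F i = z].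
have psiF i : i < mu -> psi (F i) = i.
  move=> imu; apply: xget_unique => // j [jmu Fji]; case: (ltgtP i j) => // ij.
    by have [_ /(_ _ ij)] := FP j jmu; rewrite Fji ltxx.
  by have [_ /(_ _ ij)] := FP i imu; rewrite Fji ltxx.
exists (fun x => psi (nxt eta x)), eta; split=> //.
- by move=> x; rewrite /psi; case: xgetP => // i _ [].
- by move=> x y xk xy ey; rewrite (nxt_acc xk xy ey).
- move=> i imu; have [Zi _] := FP i imu; apply: stationary_sub Zi.
  by move=> x [_ /= ->]; apply: psiF.
Qed.

(** * Highest points of walks between members of a family *)

Section Peak.
Context (mu : O) (mureg : infinite_regular_cardinal mu) (muk : mu < k).
Context (h : O -> O) (eta : O) (etak : eta < k) (hmu : forall x, h x < mu).
Context (hacc : forall x y, x < k -> acc (C x) y -> eta < y -> h y = h x).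
Context (hstat : forall i, i < mu -> stationary k [set x | h x = i]).

Definition peaks a b :=
  [set x | visited a b x /\ forall y, visited a b y -> h y <= h x].

(** Several points may share the highest level; taking the least makes [peak] depend on the set
    [peaks] alone. *)
Definition peak a b := least (peaks a b).

Lemma peaks_nonempty a b : positive a -> a < b -> b < k -> peaks a b !=set0.
Proof.
move=> apos; elim/wo_ind: b => b IH ab bk.
have [_ an nb _] := nxtP apos ab bk.
move: an; rewrite le_eqVlt => /orP[/eqP an|an].
  exists b; split; first exact: visited_refl.
  by move=> y; rewrite (visitedE _ ab) -an => -[->//|/visited_lt]; rewrite ltxx.
have [x [vx xmax]] := IH _ nb an (lt_trans nb bk).
have [hxb|hbx] := leP (h x) (h b).
  exists b; split; first exact: visited_refl.
  move=> y; rewrite (visitedE _ ab) => -[->//|/xmax hy]; exact: le_trans hxb.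
exists x; split; first exact: visited_step.
by move=> y; rewrite (visitedE _ ab) => -[->|/xmax//]; apply: ltW.
Qed.

Lemma visited_bounded a b : positive a -> b < k ->
  exists2 i, i < mu & forall x, visited a b x -> h x <= i.
Proof.
move=> apos bk; have [ab|ba] := ltP a b.
  by have [x [_ xmax]] := peaks_nonempty apos ab bk; exists (h x).
have [m mmu] := reg_pos mureg; exists m => // x /visited_lt.
by rewrite ltNge ba.
Qed.

(** Once some point exceeds level [i], only such points compete, and the two walks share them. *)
Lemma peak_eq i a b c e :
  (forall x, visited a b x -> h x <= i \/ visited c e x) ->
  (forall x, visited c e x -> i < h x -> visited a b x) ->
  (exists2 x, visited c e x & i < h x) -> peak a b = peak c e.
Proof.
move=> sub sup [z vz iz]; congr (least _); apply/seteqP; split=> x [vx xmax].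
  have ix : i < h x by exact: lt_le_trans iz (xmax _ (sup _ vz iz)).
  split; first by case: (sub x vx) => //; rewrite leNgt ix.
  move=> y vy; have [yi|iy] := leP (h y) i; first exact: le_trans yi (ltW ix).
  by apply: xmax; apply: sup.
have ix : i < h x by exact: lt_le_trans iz (xmax _ vz).
split; first exact: sup.
by move=> y /sub[yi|/xmax//]; apply: le_trans yi (ltW ix).
Qed.

Context (s : O) (A : set (set O)).
Context (As : A `<=` subsets_of_otype k s) (Adisj : trivIset A id) (Ak : A #= seg k).

Lemma family_nonempty a : A a -> a !=set0.
Proof.
move=> Aa; apply: contrapT => /set0P/negP/negPn/eqP a0; subst a.
have [_ [f [_ f0]]] := As Aa.
have s0 : seg s = set0 by rewrite (image_set0_set0 f0).
have A0 : A `<=` [set set0] by move=> a /As[_ [g [_ <-]]]; rewrite s0 image_set0.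
have [kinf _ _] := kreg; apply: kinf.
apply: (@card_le_finite _ _ _ [set (set0 : set O)]); last exact: finite_set1.
have kA : seg k #<= A by move: Ak; rewrite card_eq_le => /andP[].
exact: card_le_trans kA (subset_card_le A0).
Qed.

(** Otherwise every member has a point up to [x]; by disjointness these are distinct, so [A] would
    have fewer than [k] members. *)
Lemma family_above x : x < k -> exists2 a, A a & forall y, a y -> x < y.
Proof.
have [_ kcard _] := kreg.
move=> /(reg_succ kreg)[x' x'k xx']; apply: contrapT => na.
pose g a := xget o [set y : O | a y /\ y <= x].
have gP a : A a -> a (g a) /\ g a <= x.
  move=> Aa; apply: (@xgetPex _ o [set y | a y /\ y <= x]).
  apply: contrapT => ny; apply: na; exists a => // y ay; rewrite ltNge.
  by apply/negP => yx; apply: ny; exists y.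
have ginj : {in A &, injective g}.
  move=> a b; rewrite !inE => Aa Ab gab; apply: Adisj => //.
  by exists (g a); split; [have [] := gP a Aa|rewrite gab; have [] := gP b Ab].
suff /(small_card kcard x'k) : A #<= seg x'.
  by apply; move: Ak; rewrite card_eq_le => /andP[].
rewrite -(card_le_eql (inj_card_eq ginj)); apply: subset_card_le.
by move=> _ [a Aa <-]; have [_ gx] := gP a Aa; apply: le_lt_trans xx'.
Qed.

Context (sk : s < k) (smu : s < mu).

Definition tame i c := forall l, l < c -> exists2 a, A a &
  (forall y, a y -> l < y /\ y < c) /\
  (forall y x, a y -> visited y c x -> h x <= i).

(** Let [c] be a limit of type [n] with a member of [A] between each [e j] and [c]. The walks from
    [c] to that member have bounded level since [s < mu], and [pigeon] bounds cofinally many of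
    these levels by one [i]. *)
Lemma tame_unbounded n : n < k -> limit_length n ->
  (forall f, (forall j, j < n -> f j < mu) -> exists2 i, i < mu &
     forall j, j < n -> exists j', [/\ j <= j', j' < n & f j' <= i]) ->
  exists2 i, i < mu & forall x, x < k -> exists c, [/\ x < c, c < k & tame i c].
Proof.
move=> nk nlim pigeon.
have tame1 x : x < k -> exists2 i, i < mu & exists c, [/\ x < c, c < k & tame i c].
  move=> xk.
  pose M z := [set m | m < k /\ exists2 a, A a & forall y, a y -> z < y /\ y < m].
  have MP z : z < k -> M z (least (M z)).
    move=> zk; have [a Aa az] := family_above zk.
    have [asub asot] := As Aa.
    have [m mk am] := otype_bounded kreg sk asot (f := id) asub.
    by apply: (@least_in _ m); split=> //; exists a => // y ay; split; auto.
  have [|e [c [[einc ec ecof] [xc ck cl]]]] :=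
      @closed_seq _ kreg n (fun z => least (M z)) x nk nlim _ xk.
    by move=> z /MP[].
  pose I j := [set i | i < mu /\ exists2 a, A a & (forall y, a y -> e j < y /\ y < c) /\
    (forall y x, a y -> visited y c x -> h x <= i)].
  have IP j : j < n -> I j (least (I j)).
    move=> jn; have ejc := ec j jn.
    have [_ [a Aa aP]] := MP _ (lt_trans ejc ck).
    have [_ asot] := As Aa.
    have [||i imu iP] := @reg_collect _ mureg s a
        (fun y i => forall x, visited y c x -> h x <= i) smu asot.
    - by move=> y i i' yi ii' _ z /yi zi; apply: le_trans ii'.
    - by move=> y ay; apply: visited_bounded => //; exists (e j); have [] := aP y ay.
    apply: (@least_in _ i); split=> //; exists a => //; split=> [y ay|y z ay].
      by have [? yG] := aP y ay; split=> //; apply: lt_trans yG (cl _ ejc).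
    exact: iP.
  have [j /IP[]//|i imu iP] := pigeon (fun j => least (I j)).
  exists i => //; exists c; split=> // l /ecof[j jn lej].
  have [j' [jj' j'n ii]] := iP j jn.
  have [_ [a Aa [ae av]]] := IP j' j'n; exists a => //; split=> [y /ae[ey yc]|y z ay v].
    split=> //; apply: le_lt_trans ey; apply: (le_trans lej).
    by move: jj'; rewrite le_eqVlt => /orP[/eqP->//|jj']; apply/ltW/einc.
  exact: le_trans (av y z ay v) ii.
(* So far [i] depends on [x]. If each [i] failed beyond some point, these [mu < k] many points would
   have a common bound [m], against [tame1] at [m]. *)
apply: contrapT => ni.
have [||m mk mP] := @reg_collect _ kreg mu (seg mu)
    (fun i x => forall c, x < c -> c < k -> ~ tame i c) muk (seg_otype mu).
- by move=> i x x' xi xx' _ c /(le_lt_trans xx'); apply: xi.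
- move=> i imu; apply: contrapT => nx; apply: ni; exists i => // x xk.
  apply: contrapT => nc; apply: nx; exists x => // c xc ck tc.
  by apply: nc; exists c.
have [i imu [c [mc ck tc]]] := tame1 m mk.
exact: mP mc ck tc.
Qed.

Context (chi : O) (chireg : infinite_regular_cardinal chi) (chik : chi < k) (schi : s < chi).

(** The bounds [e0] on the peak and [i0] on its level serve the two kinds of colour. Above level
    [i4], every walk from [b] to [a] has the same points as the walk from [delta] to [c]. *)
Lemma peak_const i1 i0 e0 : i1 < mu -> i0 < mu -> e0 < k ->
  (forall x, x < k -> exists c, [/\ x < c, c < k & tame i1 c]) ->
  exists a b x, [/\ family_pairs A (a, b), e0 < x, x < k, i0 < h x &
    forall y z, a y -> b z -> peak y z = x].
Proof.
move=> i1mu i0mu e0k tameP.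
have chilim : limit_length chi by split; [apply: reg_pos|apply: reg_succ].
pose T x := [set c | [/\ x < c, c < k & tame i1 c]].
have TP x : x < k -> T x (least (T x)) by move=> /tameP[c Tc]; apply: (@least_in _ c).
pose G x := least (T x).
have Gk : maps_seg k G by move=> x /TP[].
(* Closure under [N] makes every level recur cofinally in [delta] at points closed under [G], which
   are limits of tame points. *)
pose N x := [set m | m < k /\ forall i, i < mu -> exists z,
  [/\ h z = i, x < z, z < m & closed_under G z]].
have NP x : x < k -> N x (least (N x)).
  move=> xk; have [||m mk mP] := @reg_collect _ kreg mu (seg mu)
      (fun i m => exists z, [/\ h z = i, x < z, z < m & closed_under G z]) muk (seg_otype mu).
  - by move=> i m m' [z [? ? zm ?]] mm' _; exists z; split=> //; apply: lt_le_trans mm'.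
  - move=> i imu; have [z [hz [xz zk cl]]] := hstat imu Gk xk.
    by have [m mk zm] := reg_succ kreg zk; exists m => //; exists z.
  by apply: (@least_in _ m).
have [x0 x0k [e0x0 ex0]] := reg_max kreg e0k etak.
have [|e [delta [[einc edelta ecof] [x0delta deltak cl]]]] :=
    @closed_seq _ kreg chi (fun z => least (N z)) x0 chik chilim _ x0k.
  by move=> z /NP[].
have deltapos : positive delta by exists x0.
have [b Ab bdelta] := family_above deltak.
have [bk bot] := As Ab.
(* Each [z] in [b] has its own threshold from [walk_split]; since [delta] is the limit of a
   [chi]-sequence and [s < chi], one [e j] exceeds them all. *)
have [||j jchi jP] := @reg_collect _ chireg s b (fun z j =>
    forall y, e j < y -> y < delta -> forall x,
    [/\ visited y z x -> visited delta z x \/ visited y delta x,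
        visited delta z x -> visited y z x
      & visited y delta x -> visited y z x \/
          x = delta /\ exists2 w, visited delta z w & acc (C w) delta]) schi bot.
- move=> z m m' zm mm' m'chi y ey; apply: zm; apply: le_lt_trans ey.
  by move: mm'; rewrite le_eqVlt => /orP[/eqP->//|mm']; apply/ltW/einc.
- move=> z bz; have [l /ecof[j jchi lj] lP] := walk_split deltapos (bdelta z bz) (bk z bz).
  by exists j => // y ey; apply: lP; apply: le_lt_trans ey.
have [||ib ibmu ibP] := @reg_collect _ mureg s b
    (fun z i => forall x, visited delta z x -> h x <= i) smu bot.
- by move=> y i i' yi ii' _ z /yi zi; apply: le_trans ii'.
- by move=> y /bk; apply: visited_bounded.
(* The level [i4] dominates [i0], [h delta] and the levels from [b] to [delta] and from [c] to [a];
   [xi] gets level [i5 > i4]. *)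
have [i2 i2mu [ib2 hd2]] := reg_max mureg ibmu (hmu delta).
have [i3 i3mu [i03 i13]] := reg_max mureg i0mu i1mu.
have [i4 i4mu [i24 i34]] := reg_max mureg i2mu i3mu.
have [i5 i5mu i45] := reg_succ mureg i4mu.
pose l0 := Order.max x0 (e j).
have l0delta : l0 < delta by rewrite gt_max x0delta edelta.
have [_ /(_ i5 i5mu)[xi [hxi l0xi xiN clxi]]] := NP l0 (lt_trans l0delta deltak).
have xidelta : xi < delta by apply: lt_trans xiN (cl _ l0delta).
have xipos : positive xi by exists l0.
have [l1 l1xi l1P] := walk_split xipos xidelta deltak.
pose l2 := Order.max l0 l1.
have l2xi : l2 < xi by rewrite gt_max l0xi.
have [l2c ck tc] : T l2 (G l2) by apply: TP; apply: lt_trans l2xi (lt_trans xidelta deltak).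
have cxi : G l2 < xi by apply: clxi.
set c := G l2 in l2c ck tc cxi.
have [l0c l1c] : l0 < c /\ l1 < c by move: l2c; rewrite gt_max => /andP.
have [x0c jc] : x0 < c /\ e j < c by move: l0c; rewrite gt_max => /andP.
have cdelta : c < delta := lt_trans cxi xidelta.
have cpos : positive c by exists l2.
have [l3 l3c l3P] := walk_split cpos cdelta deltak.
have [|a Aa [al ai]] := tc (Order.max l0 l3); first by rewrite gt_max l0c.
(* The walk from [delta] to [c] may miss [xi]; then it visits some [y] with [xi] in [acc (C y)],
   which has the same level by [hacc]. *)
have high : exists2 x, visited c delta x & i4 < h x.
  have [_ _ /(_ (visited_refl cxi))[v|[_ [y vy yacc]]]] := l1P c l1c cxi xi.
    by exists xi => //; rewrite hxi.
  have [_ /(_ vy)v _] := l1P c l1c cxi y.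
  exists y => //; rewrite -(hacc _ yacc) ?hxi //.
    exact: le_lt_trans (visited_le xipos deltak vy) deltak.
  exact: lt_trans ex0 (lt_trans x0c cxi).
have [vp pmax] : peaks c delta (peak c delta).
  by have [p pP] := peaks_nonempty cpos cdelta deltak; apply: (@least_in _ p).
exists a, b, (peak c delta); split.
- split=> // y z ay bz; have [_ yc] := al y ay.
  by apply: lt_trans yc (lt_trans cdelta (bdelta z bz)).
- exact: lt_trans e0x0 (lt_trans x0c (visited_gt vp)).
- exact: le_lt_trans (visited_le cpos deltak vp) deltak.
- have [x vx ix] := high.
  by apply: lt_trans (lt_le_trans ix (pmax x vx)); apply: lt_trans i34.
move=> y z ay bz; have [ly yc] := al y ay.
have [l0y l3y] : l0 < y /\ l3 < y by move: ly; rewrite gt_max => /andP.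
have jy : e j < y by move: l0y; rewrite gt_max => /andP[].
have ydelta := lt_trans yc cdelta.
apply: (@peak_eq i4) high => [x|x vx ix].
- have [h1 _ _] := jP z bz y jy ydelta x.
  have [h2 _ _] := l3P y l3y yc x.
  move=> /h1[v|/h2[v|v]]; [left|by right|left].
    by apply: le_trans (ibP z bz x v) (ltW (lt_trans ib2 i24)).
  by apply: le_trans (ai y x ay v) (ltW (lt_trans i13 i34)).
- have [_ h2 _] := l3P y l3y yc x; have [_ _ h3] := jP z bz y jy ydelta x.
  (* The exception of [walk_split] concerns only [delta], whose level is below [i4]. *)
  case: (h3 (h2 vx)) => [//|[xd _]].
  by move: ix; rewrite xd ltNge (ltW (lt_trans hd2 i24)).
Qed.

End Peak.
End Walks.

(** * Countable ordinals and a pigeonhole principle *)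

Lemma countable_setU T (A B : set T) :
  countable A -> countable B -> countable (A `|` B).
Proof.
by move=> Ac Bc; rewrite -bigcup2E; apply: bigcup_countable => // -[|[|i]] _ //=.
Qed.

Section Aleph1.
Context (aleph1 : O) (aleph1P : is_aleph1 aleph1).

(** An unbounded [B] would make [aleph1] a countable union of countable segments. *)
Lemma aleph1_bounded B : countable B -> B `<=` seg aleph1 ->
  exists2 m, m < aleph1 & forall b, B b -> b < m.
Proof.
have [nc cP] := aleph1P; move=> Bc Bsub; apply: contrapT => nm; apply: nc.
apply: (@sub_countable _ _ _ (\bigcup_(b in B) (seg b `|` [set b]))); last first.
  apply: bigcup_countable => // b Bb; apply: countable_setU; [exact/cP/Bsub|exact: countable1].
apply: subset_card_le => x xa; apply: contrapT => nx; apply: nm; exists x => // b Bb.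
rewrite ltNge le_eqVlt; apply/negP => /orP[/eqP xb|xb]; apply: nx; exists b => //.
  by right.
by left.
Qed.

(** The cofinality of [n] must differ from that of [mu]: [n] is [aleph1] if [mu] is countable and
    omega otherwise. *)
Lemma pigeonhole_length mu : infinite_regular_cardinal mu ->
  exists n, [/\ n <= aleph1, limit_length n &
   forall f, (forall j, j < n -> f j < mu) -> exists2 i, i < mu &
     forall j, j < n -> exists j', [/\ j <= j', j' < n & f j' <= i]].
Proof.
move=> mureg; have [nc cP] := aleph1P.
have [muc|munc] := pselect (countable (seg mu)).
  exists aleph1; split=> //.
    split=> [|j ja]; first by have [//|m ma _] := aleph1_bounded (countable0 O); exists m.
    have [|m ma jm] := aleph1_bounded (countable1 j); first by move=> _ ->.
    by exists m => //; apply: jm.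
  move=> f fmu; apply: contrapT => ni.
  (* From [g i] on, [f] stays above [i]; at an [m] beyond these countably many points, [f m] would
     exceed itself. *)
  have /choice[g gP] : forall i, exists j, i < mu -> j < aleph1 /\
      forall j', j <= j' -> j' < aleph1 -> i < f j'.
    move=> i; apply: contrapT => nj; apply: ni; exists i.
      by apply: contrapT => imu; apply: nj; exists i => /imu.
    move=> j ja; apply: contrapT => nj'; apply: nj; exists j => imu; split=> // j' jj' j'a.
    by rewrite ltNge; apply/negP => fi; apply: nj'; exists j'.
  have [||m ma gm] := @aleph1_bounded (g @` seg mu).
  - exact: sub_countable (card_image_le _ _) muc.
  - by move=> _ [i imu <-]; have [] := gP i imu.
  have fm := fmu m ma; have [_ /(_ m)] := gP _ fm.
  by rewrite ltxx => abs; suff: false by []; apply: abs => //; apply/ltW/gm; exists (f m).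
pose n := least [set x | infinite_set (seg x)].
have ainf : infinite_set (seg aleph1) by move=> /finite_set_countable.
have ninf : infinite_set (seg n) by apply: (@least_in [set x | infinite_set (seg x)] aleph1).
have nmin y : y < n -> finite_set (seg y).
  move=> yn; apply: contrapT => yinf.
  have : n <= y by apply: (@least_le [set x | infinite_set (seg x)]).
  by rewrite leNgt yn.
have na : n <= aleph1 by apply: (@least_le [set x | infinite_set (seg x)]).
have ncount : countable (seg n).
  move: na; rewrite le_eqVlt => /orP[/eqP na|/cP//].
  (* If [aleph1] were omega, a countably infinite subset would be bounded in it, hence inside a
     finite segment. *)
  have /infiniteP/card_subP[B BN Bn] := ninf.
  have [||m ma Bm] := @aleph1_bounded B.
  - by move: BN; rewrite card_eq_le => /andP[].
  - by rewrite -na.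
  have /infinite_nat [] : finite_set [set: nat].
  rewrite -(eq_finite_set BN); apply: sub_finite_set (nmin m _); last by rewrite na.
  by move=> b /Bm.
exists n; split=> //.
  split=> [|j jn]; first by have [x xn] := infinite_setN0 ninf; exists x.
  apply: contrapT => nj; apply: ninf.
  apply: (@sub_finite_set _ _ (seg j `|` [set j])).
    move=> x xn; case: (ltgtP x j) => [xj|jx|->]; [by left| |by right].
    by exfalso; apply: nj; exists x.
  by rewrite finite_setU; split; [apply: nmin|apply: finite_set1].
move=> f fmu; have [||m mmu fm] := @reg_countable _ mureg (f @` seg n) munc.
- by move=> _ [j jn <-]; apply: fmu.
- exact: sub_countable (card_image_le _ _) ncount.
by exists m => // j jn; exists j; split=> //; apply/ltW/fm; exists j.
Qed.

End Aleph1.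
End WellOrdered.

(** * The colouring and its two cases *)

Theorem theoremB (d : Order.disp_t) (O : orderType d)
    (wo : well_order (<=%O : rel O))
    (chi theta kappa aleph1 : O)
    (chi_reg : infinite_regular_cardinal chi)
    (theta_reg : infinite_regular_cardinal theta)
    (kappa_reg : infinite_regular_cardinal kappa)
    (chi_le_theta : chi <= theta)
    (theta_le_kappa : theta <= kappa)
    (aleph1_def : is_aleph1 aleph1)
    (max_lt_kappa : Order.max chi aleph1 < kappa) :
  square kappa -> U1_2 kappa theta chi.
Proof.
move=> [C [Cclosed Ccoh Cthread]].
have [chik alephk] : chi < kappa /\ aleph1 < kappa.
  by move: max_lt_kappa; rewrite gt_max => /andP.
pose mu := if theta < kappa then theta else chi.
have mureg : infinite_regular_cardinal mu by rewrite /mu; case: ifP.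
have muk : mu < kappa by rewrite /mu; case: ifP.
have chimu : chi <= mu by rewrite /mu; case: ifP.
have chilim : limit_length chi.
  by split; [apply: reg_pos|apply: (reg_succ wo chi)].
have [h [eta [etak hmu hacc hstat]]] :=
  coherent_colouring wo chi kappa_reg Cclosed Ccoh chik chilim Cthread mureg muk.
have [z0 z0theta] := reg_pos theta_reg.
pose v p := peak chi C h p.1 p.2.
pose w p := if theta < kappa then h (v p) else v p.
(* The default [z0] keeps all values below [theta]; it does not occur on the pairs given by
   [spread]. *)
pose c p := if w p < theta then w p else z0.
exists c; split=> [p _|s schi A As Adisj Ak e etheta]; first by rewrite /c; case: ifP.
have [n [na nlim pigeon]] := pigeonhole_length wo chi aleph1_def mureg.
have smu : s < mu := lt_le_trans schi chimu.
have sk : s < kappa := lt_trans smu muk.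
have nk : n < kappa := le_lt_trans na alephk.
have [i1 i1mu tameP] := tame_unbounded wo chi kappa_reg Cclosed mureg muk hmu
  As Adisj Ak sk smu nk nlim pigeon.
have spread i0 e0 (i0mu : i0 < mu) (e0k : e0 < kappa) :=
  peak_const wo kappa_reg Cclosed Ccoh mureg muk etak hmu hacc
    hstat As Adisj Ak smu chi_reg chik schi i1mu i0mu e0k tameP.
suff [a [b [t [Aab ttheta et ct]]]] : exists a b t,
    [/\ family_pairs A (a, b), t < theta, e < t & forall y z, a y -> b z -> c (y, z) = t].
  exists a, b, t; split=> //; have [Aa Ab _] := Aab.
  have [y ay] := family_nonempty kappa_reg As Ak Aa.
  have [z bz] := family_nonempty kappa_reg As Ak Ab.
  apply/seteqP; split=> [_ [[y' z'] [/= ay' bz'] <-]|_ ->]; first exact: ct.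
  by exists (y, z) => //; apply: ct.
have [tk|kt] := boolP (theta < kappa).
  have muE : mu = theta by rewrite /mu tk.
  (* The colour is the level of the peak, so the level must exceed [e]. *)
  have [||a [b [x [Aab _ _ ex px]]]] := spread e e; first by rewrite muE.
    exact: lt_trans tk.
  have htheta : h x < theta by rewrite -muE.
  exists a, b, (h x); split=> // y z ay bz.
  by rewrite /c /w /v tk /= px // htheta.
have tE : theta = kappa by apply/eqP; rewrite eq_le theta_le_kappa leNgt kt.
have [m0 m0mu] := reg_pos mureg.
(* The colour is the peak itself, so its position must exceed [e]. *)
have [||a [b [x [Aab ex xk _ px]]]] := spread m0 e => //; first by rewrite -tE.
have xtheta : x < theta by rewrite tE.
exists a, b, x; split=> // y z ay bz.
by rewrite /c /w /v (negbTE kt) /= px // xtheta.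
Qed.
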